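(* Let $C=L_1;L_2$ be a saturated two-layer comparator network on $n$ channels. Then none of the following configurations occurs in $C$ (all named channels distinct; ''used in $L_k$'' means belonging to some comparator of $L_k$; ''joined externally in $L_2$'' means belonging to a comparator of $L_2$ whose other channel is not among the named channels of the configuration): (1a) channels $a,b,c$ with $(a,b)\in L_1$, $c$ used in neither $L_1$ nor $L_2$, $b$ not used in $L_2$, and $a$ joined externally in $L_2$; (1b) channels $a,b,c$ with $(a,b)\in L_1$, $c$ used in neither $L_1$ nor $L_2$, $a$ not used in $L_2$, and $b$ joined externally in $L_2$; (1c) channels $a,b,c$ with $(a,b)\in L_1$, $c$ used in neither $L_1$ nor $L_2$, and neither $a$ nor $b$ used in $L_2$; (2) channels $a,b,c,d$ with $(a,b),(c,d)\in L_1$, $a$ and $d$ not used in $L_2$, and each of $b$ and $c$ joined externally in $L_2$; (3a) channels $a,b,c,d$ with $(a,b),(c,d)\in L_1$, $L_2$ containing a comparator between $a$ and $c$, and $b,d$ not used in $L_2$; (3b) channels $a,b,c,d$ with $(a,b),(c,d)\in L_1$, $L_2$ containing a comparator between $b$ and $d$, and $a,c$ not used in $L_2$.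
   Context: A comparator network on $n$ channels is a sequence of layers; each layer is a set of comparators $(i,j)$, $1\le i<j\le n$, with each channel in at most one comparator of the layer. On an input, comparator $(i,j)$ places the minimum of the values on channels $i,j$ on channel $i$ and the maximum on channel $j$; untouched channels keep their values. $\mathrm{outputs}(C)=\{C(\vec x):\vec x\in\{0,1\}^n\}$. For a permutation $\pi$ of $\{1,\ldots,n\}$, $\pi(\vec x)$ is the vector $\vec y$ with $y_{\pi(i)}=x_i$, extended elementwise to sets. $C$ is redundant if removing some comparator yields $C'$ with $\mathrm{outputs}(C')=\pi(\mathrm{outputs}(C))$ for some permutation $\pi$. $C$ is saturated if it is not redundant and every network $C'$ obtained from $C$ by adding one comparator (to a layer, on two channels not used in that layer) satisfies $\mathrm{outputs}(C')\not\subseteq\pi(\mathrm{outputs}(C))$ for every permutation $\pi$. *)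

(* Defs.v *)
From mathcomp Require Import all_boot all_order all_fingroup.
Set Implicit Arguments.
Unset Strict Implicit.
Unset Printing Implicit Defensive.

(* Channels are 'I_n, numbered from 0. *)
Definition comparator (n : nat) : Type := ('I_n * 'I_n)%type.
Definition layer (n : nat) : Type := {set 'I_n * 'I_n}.
Definition network (n : nat) : Type := seq (layer n).

Definition on_channel (n : nat) (c : comparator n) (k : 'I_n) : bool :=
  (c.1 == k) || (c.2 == k).

Definition used (n : nat) (L : layer n) (k : 'I_n) : bool :=
  [exists c in L, on_channel c k].

Definition is_layer (n : nat) (L : layer n) : Prop :=
  (forall c, c \in L -> c.1 < c.2) /\
  (forall c c' k, c \in L -> c' \in L ->
     on_channel c k -> on_channel c' k -> c = c').

Definition is_network (n : nat) (C : network n) : Prop :=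
  forall L, L \in C -> is_layer L.

(* In a valid layer at most one comparator touches k, so both picks are
   determined and at most one of them succeeds. *)
Definition apply_layer (n : nat) (d : Order.disp_t) (T : orderType d)
    (L : layer n) (x : {ffun 'I_n -> T}) : {ffun 'I_n -> T} :=
  [ffun k =>
     if [pick c in L | c.1 == k] is Some c then Order.min (x c.1) (x c.2)
     else if [pick c in L | c.2 == k] is Some c then Order.max (x c.1) (x c.2)
     else x k].

Definition run (n : nat) (d : Order.disp_t) (T : orderType d)
    (C : network n) (x : {ffun 'I_n -> T}) : {ffun 'I_n -> T} :=
  foldl (fun y L => apply_layer L y) x C.

Definition outputs (n : nat) (C : network n) : {set {ffun 'I_n -> bool}} :=
  [set run C x | x : {ffun 'I_n -> bool}].

(* The vector y with y (p i) = x i. *)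
Definition permute (n : nat) (p : 'S_n) (x : {ffun 'I_n -> bool}) :
    {ffun 'I_n -> bool} :=
  [ffun k => x ((p^-1)%g k)].

Definition permute_set (n : nat) (p : 'S_n) (X : {set {ffun 'I_n -> bool}}) :
    {set {ffun 'I_n -> bool}} :=
  [set permute p x | x in X].

Definition removal (n : nat) (C C' : network n) : Prop :=
  exists (k : nat) (c : comparator n),
    [/\ k < size C, c \in nth set0 C k
      & C' = set_nth set0 C k (nth set0 C k :\ c)].

Definition addition (n : nat) (C C' : network n) : Prop :=
  exists (k : nat) (i j : 'I_n),
    [/\ k < size C, i < j, ~~ used (nth set0 C k) i, ~~ used (nth set0 C k) j
      & C' = set_nth set0 C k ((i, j) |: nth set0 C k)].

Definition redundant (n : nat) (C : network n) : Prop :=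
  exists C' : network n, removal C C' /\
    exists p : 'S_n, outputs C' = permute_set p (outputs C).

Definition saturated (n : nat) (C : network n) : Prop :=
  ~ redundant C /\
  forall C' : network n, addition C C' ->
    forall p : 'S_n, ~ (outputs C' \subset permute_set p (outputs C)).

Definition joined (n : nat) (L : layer n) (i j : 'I_n) : bool :=
  ((i, j) \in L) || ((j, i) \in L).

(* s lists the named channels of a configuration. *)
Definition joined_ext (n : nat) (L : layer n) (s : seq 'I_n) (i : 'I_n) : bool :=
  [exists j, (j \notin s) && joined L i j].

(* Main.v *)
Require Import Defs.
From mathcomp Require Import all_boot all_order all_fingroup.

(** Every excluded configuration is refuted by adding to L2 one comparator on
    two channels u, v that L2 leaves free, say with minimum on u. Since L2
    ignores u and v, this amounts to sorting y u and y v between the two layers.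
    Outputs of L1 are exactly the vectors y with y i <= y j for all (i, j) in L1,
    and in each configuration the vector sorted at u, v still satisfies these
    inequalities (in (3), after also sorting the two channels that L2 compares,
    which L2 does not notice). So no new output arises. If u > v, the comparator
    puts its minimum on v instead, which the transposition of u and v corrects. *)

(** * Pointwise action of a single layer *)

Section Layer.
Set Implicit Arguments.
Unset Strict Implicit.
Variables (n : nat) (L : layer n).
Hypothesis layerL : is_layer L.

Lemma used_fst c : c \in L -> used L c.1.
Proof. by move=> cL; apply/existsP; exists c; rewrite cL /on_channel eqxx. Qed.

Lemma used_snd c : c \in L -> used L c.2.
Proof. by move=> cL; apply/existsP; exists c; rewrite cL /on_channel eqxx orbT. Qed.

Lemma usedP k : reflect (exists2 c, c \in L & k = c.1 \/ k = c.2) (used L k).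
Proof.
apply: (iffP existsP) => [[c /andP[cL /orP[] /eqP <-]]|[c cL [] ->]].
- by exists c; last left.
- by exists c; last right.
- by exists c; rewrite cL /on_channel eqxx.
- by exists c; rewrite cL /on_channel eqxx orbT.
Qed.

Lemma layer_inj c c' k : c \in L -> c' \in L ->
  on_channel c k -> on_channel c' k -> c = c'.
Proof. by case: layerL => _; apply. Qed.

Lemma layer_neq u v : (u, v) \in L -> (v == u) = false.
Proof. by move=> /layerL.1 uv; rewrite -val_eqE gtn_eqF. Qed.

(** The case split behind every check of a layer's inequalities after sorting two channels. The four
    equations are oriented to reduce the tests in [sort_pair]. *)
Lemma layer_disjoint u v c : (u, v) \in L -> c \in L -> c = (u, v) \/
  [/\ c.1 == u = false, c.1 == v = false, c.2 == u = false & c.2 == v = false].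
Proof.
move=> uvL cL; have [->|ne] := eqVneq c (u, v); [by left|right].
have off k : on_channel (u, v) k -> on_channel c k = false.
  by move=> uvk; apply: contraNF ne => /(layer_inj cL uvL) ->.
have := off u; have := off v; rewrite /on_channel /= !eqxx orbT.
by move=> /(_ isT)/norP[/negPf -> /negPf ->] /(_ isT)/norP[/negPf -> /negPf ->].
Qed.

Lemma unused_neq c k : ~~ used L k -> c \in L ->
  (c.1 == k = false) * (c.2 == k = false).
Proof.
move=> kL cL; split; apply: contraNF kL => /eqP <-.
  exact: used_fst.
exact: used_snd.
Qed.

Variables (d : Order.disp_t) (T : orderType d).
Implicit Types x y : {ffun 'I_n -> T}.

Lemma apply_layer_fst c x : c \in L ->
  apply_layer L x c.1 = Order.min (x c.1) (x c.2).
Proof.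
move=> cL; rewrite ffunE; case: pickP => [c' /andP[c'L c'1]|/(_ c)]; last first.
  by rewrite cL eqxx.
by rewrite (@layer_inj c' c c.1) // /on_channel ?c'1 ?eqxx.
Qed.

Lemma apply_layer_snd c x : c \in L ->
  apply_layer L x c.2 = Order.max (x c.1) (x c.2).
Proof.
move=> cL; rewrite ffunE; case: pickP => [c' /andP[c'L c'2]|_].
  (* The min test comes first in [apply_layer]. A comparator with its minimum on [c.2] would have to
     be [c], giving [c.1 = c.2] against [c.1 < c.2]. *)
  have e : c' = c by apply: (@layer_inj c' c c.2); rewrite /on_channel ?c'2 ?eqxx ?orbT.
  by have := layerL.1 c cL; move: c'2; rewrite e => /eqP ->; rewrite ltnn.
case: pickP => [c' /andP[c'L c'2]|/(_ c)]; last by rewrite cL eqxx.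
by rewrite (@layer_inj c' c c.2) // /on_channel ?c'2 ?eqxx orbT.
Qed.

Lemma apply_layer_unused k x : ~~ used L k -> apply_layer L x k = x k.
Proof.
move=> kL; rewrite ffunE; case: pickP => [c /andP[cL /eqP ck]|_].
  by move: kL; rewrite -ck used_fst.
case: pickP => [c /andP[cL /eqP ck]|//].
by move: kL; rewrite -ck used_snd.
Qed.

Lemma eq_apply_layer k x y : (forall l, used L l -> x l = y l) ->
  used L k -> apply_layer L x k = apply_layer L y k.
Proof.
move=> xy /usedP[c cL [] ->].
  by rewrite !apply_layer_fst // !xy ?used_fst ?used_snd.
by rewrite !apply_layer_snd // !xy ?used_fst ?used_snd.
Qed.

End Layer.

(** * Boolean vectors, layer inequalities and sorting of two channels *)

Section Boolean.
Set Implicit Arguments.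
Unset Strict Implicit.
Variable n : nat.
Implicit Types (L : layer n) (x y : {ffun 'I_n -> bool}) (u v : 'I_n).

Definition respects L y : Prop := forall c, c \in L -> y c.1 ==> y c.2.

(** A comparator of either direction: [u] may exceed [v], and [u] still receives the minimum. *)
Definition sort_pair u v y : {ffun 'I_n -> bool} :=
  [ffun k => if k == u then y u && y v
             else if k == v then y u || y v else y k].

Lemma apply_layer_respects L x : is_layer L -> respects L (apply_layer L x).
Proof.
move=> hL c cL; rewrite apply_layer_fst // apply_layer_snd //.
by case: (x c.1) (x c.2) => [] [].
Qed.

(** Sorted pairs are left alone. With [apply_layer_respects], this makes the vectors respecting a
    layer exactly its outputs. *)
Lemma apply_layer_id L y : is_layer L -> respects L y -> apply_layer L y = y.
Proof.
move=> hL hy; apply/ffunP => k; case: (boolP (used L k)) => [|kL]; last first.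
  exact: apply_layer_unused.
case/usedP=> c cL [] ->; move: (hy c cL).
  by rewrite apply_layer_fst //; case: (y c.1) (y c.2) => [] [].
by rewrite apply_layer_snd //; case: (y c.1) (y c.2) => [] [].
Qed.

Lemma is_layer_add L u v : is_layer L -> u < v ->
  ~~ used L u -> ~~ used L v -> is_layer ((u, v) |: L).
Proof.
move=> hL uv uL vL.
have free c k : c \in L -> on_channel c k -> on_channel (u, v) k -> False.
  move=> cL ck; have kL : used L k by apply/existsP; exists c; rewrite cL.
  by case/orP=> /eqP /= e; move: kL; rewrite -e ?(negPf uL) ?(negPf vL).
split=> [c|c c' k]; rewrite !inE.
  by case/orP=> [/eqP ->|/(hL.1)].
case/orP=> [/eqP ->|cL] /orP[/eqP ->|c'L] // ck c'k.
- by case: (free c' k).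
- by case: (free c k).
- exact: (layer_inj hL cL c'L ck).
Qed.

(** The new comparator shares no channel with [L], so it may as well act before it. *)
Lemma apply_layer_add L u v y : is_layer L -> u < v ->
  ~~ used L u -> ~~ used L v ->
  apply_layer ((u, v) |: L) y = apply_layer L (sort_pair u v y).
Proof.
move=> hL uv uL vL; have hL' := is_layer_add hL uv uL vL.
have uvL : (u, v) \in (u, v) |: L by rewrite setU11.
have vu : (v == u) = false by rewrite -val_eqE gtn_eqF.
apply/ffunP => k.
have [->|ku] := eqVneq k u.
  rewrite (apply_layer_fst hL' y uvL) /= apply_layer_unused // ffunE eqxx.
  by case: (y u) (y v) => [] [].
have [->|kv] := eqVneq k v.
  rewrite (apply_layer_snd hL' y uvL) /= apply_layer_unused // ffunE eqxx vu.
  by case: (y u) (y v) => [] [].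
have sortE l : used L l -> sort_pair u v y l = y l.
  move=> lL; rewrite ffunE.
  have [lu|_] := eqVneq l u; first by rewrite lu (negPf uL) in lL.
  by have [lv|//] := eqVneq l v; rewrite lv (negPf vL) in lL.
case: (boolP (used L k)) => [kL|kL].
  rewrite (eq_apply_layer hL sortE kL); case/usedP: kL => c cL.
  have cL' : c \in (u, v) |: L by rewrite setU1r.
  case=> ->; first by rewrite !apply_layer_fst.
  by rewrite !apply_layer_snd.
rewrite !apply_layer_unused ?ffunE ?(negPf ku) ?(negPf kv) //.
apply: contra kL => /usedP[c]; rewrite !inE => /orP[/eqP -> /=|cL ck].
  by case=> e; rewrite e eqxx in ku kv.
by apply/usedP; exists c.
Qed.

(** Reversing the direction only swaps the values on [u] and [v], which [L] neither reads nor
    changes. *)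
Lemma apply_layer_sort_pairC L u v y : is_layer L -> u != v ->
  ~~ used L u -> ~~ used L v ->
  apply_layer L (sort_pair v u y) =
  permute (tperm u v) (apply_layer L (sort_pair u v y)).
Proof.
move=> hL uv uL vL; apply/ffunP => k; rewrite [RHS]ffunE tpermV.
have vu : (v == u) = false by rewrite eq_sym (negPf uv).
case: tpermP => [->|->|/eqP ku /eqP kv].
- by rewrite !apply_layer_unused // !ffunE !eqxx (negPf uv) vu orbC.
- by rewrite !apply_layer_unused // !ffunE !eqxx andbC.
case: (boolP (used L k)) => [kL|kL]; last first.
  by rewrite !apply_layer_unused // !ffunE (negPf ku) (negPf kv).
apply: eq_apply_layer => // l lL; rewrite !ffunE.
have [lu|_] := eqVneq l u; first by rewrite lu (negPf uL) in lL.
by have [lv|//] := eqVneq l v; rewrite lv (negPf vL) in lL.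
Qed.

(** Sorting a pair twice is sorting it once, and no other comparator of [L] sees these channels. *)
Lemma apply_layer_absorb L u v y : is_layer L -> (u, v) \in L ->
  apply_layer L (sort_pair u v y) = apply_layer L y.
Proof.
move=> hL uvL.
have vu := layer_neq hL uvL.
apply/ffunP => k; case: (boolP (used L k)) => [/usedP[c cL]|kL].
  case=> ->; [rewrite !apply_layer_fst //|rewrite !apply_layer_snd //];
    case: (layer_disjoint hL uvL cL) => [->|[c1u c1v c2u c2v]];
    rewrite !ffunE /= ?eqxx ?vu ?c1u ?c1v ?c2u ?c2v //;
    by case: (y u) (y v) => [] [].
rewrite !apply_layer_unused // ffunE.
have [ku|_] := eqVneq k u; first by rewrite ku (used_fst uvL) in kL.
by have [kv|//] := eqVneq k v; rewrite kv (used_snd uvL) in kL.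
Qed.

(** * Consequences of saturation for two layers *)

Variables L1 L2 : layer n.
Hypotheses (layerL1 : is_layer L1) (layerL2 : is_layer L2).
Hypothesis sat : saturated [:: L1; L2].

(** Turns saturation into a statement about vectors between the layers: sorting two free channels
    there must create a new output for some vector respecting [L1]. *)
Lemma saturated_pair u v : u != v -> ~~ used L2 u -> ~~ used L2 v ->
  ~ forall y, respects L1 y -> exists2 y', respects L1 y' &
      apply_layer L2 (sort_pair u v y) = apply_layer L2 y'.
Proof.
move=> uv uL vL sim.
have sub (p : 'S_n) (i j : 'I_n) : i < j -> ~~ used L2 i -> ~~ used L2 j ->
    (forall y, apply_layer L2 (sort_pair i j y) =
               permute p (apply_layer L2 (sort_pair u v y))) -> False.
  (* Layers are indexed from 0, so index 1 below is the second layer. *)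
  move=> ij iL jL eqp; apply: (sat.2 [:: L1; (i, j) |: L2] _ p).
    by exists 1, i, j.
  apply/subsetP => z /imsetP[x _ ->] /=.
  rewrite apply_layer_add // eqp.
  have [y' y'L1 ->] := sim _ (apply_layer_respects x layerL1).
  (* [y'] serves as its own input, since [L1] fixes it. *)
  apply: imset_f; apply/imsetP; exists y' => //=.
  by rewrite (apply_layer_id layerL1 y'L1).
have [lt_uv|lt_vu|e] := ltngtP u v.
- apply: (sub 1%g u v) => // y; apply/ffunP => k.
  by rewrite [RHS]ffunE invg1 perm1.
- by apply: (sub (tperm u v) v u) => // y; apply: apply_layer_sort_pairC.
- by rewrite (val_inj e) eqxx in uv.
Qed.

(** Sending the maximum to [b] can only raise [y b], which keeps [y a <= y b]; [c] is under no
    constraint from [L1]. *)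
Lemma saturated_no_upper a b c : (a, b) \in L1 -> c != b ->
  ~~ used L1 c -> ~~ used L2 c -> ~~ used L2 b -> False.
Proof.
move=> abL cb cL1 cL2 bL2; apply: (saturated_pair cb cL2 bL2) => y hy.
exists (sort_pair c b y) => // k kL; have := hy k kL.
have [k1c k2c] := unused_neq cL1 kL.
case: (layer_disjoint layerL1 abL kL) => [ek|[_ k1b _ k2b]]; last first.
  by rewrite !ffunE k1b k1c k2b k2c.
rewrite ek /= in k1c k2c *.
rewrite !ffunE k1c k2c eqxx [a == b]eq_sym (layer_neq layerL1 abL).
by case: (y a) (y b) (y c) => [] [] [].
Qed.

(** Dual to the previous case: the value on [a] can only drop. *)
Lemma saturated_no_lower a b c : (a, b) \in L1 -> a != c ->
  ~~ used L1 c -> ~~ used L2 c -> ~~ used L2 a -> False.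
Proof.
move=> abL ac cL1 cL2 aL2; apply: (saturated_pair ac aL2 cL2) => y hy.
exists (sort_pair a c y) => // k kL; have := hy k kL.
have [k1c k2c] := unused_neq cL1 kL.
case: (layer_disjoint layerL1 abL kL) => [ek|[k1a _ k2a _]]; last first.
  by rewrite !ffunE k1a k1c k2a k2c.
rewrite ek /= in k1c k2c *.
rewrite !ffunE k2c eqxx (layer_neq layerL1 abL).
by case: (y a) (y b) (y c) => [] [] [].
Qed.

(** Sorting [a] and [d] lowers the first and raises the second, so both inequalities survive. *)
Lemma saturated_no_lower_upper a b c d : uniq [:: a; b; c; d] ->
  (a, b) \in L1 -> (c, d) \in L1 -> ~~ used L2 a -> ~~ used L2 d -> False.
Proof.
rewrite /= !inE !negb_or -!andbA => /and5P[ab ac ad bc /and3P[bd cd _]].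
move=> abL cdL aL2 dL2; apply: (saturated_pair ad aL2 dL2) => y hy.
exists (sort_pair a d y) => // k kL; have := hy k kL.
have := hy _ abL; have := hy _ cdL.
rewrite !ffunE /=.
case: (layer_disjoint layerL1 abL kL) => [->|[k1a k1b k2a k2b]] /=.
  rewrite eqxx [b == a]eq_sym (negPf ab) (negPf bd).
  by case: (y a) (y b) (y c) (y d) => [] [] [] [].
case: (layer_disjoint layerL1 cdL kL) => [->|[k1c k1d k2c k2d]] /=.
  rewrite eqxx [c == a]eq_sym [d == a]eq_sym (negPf ac) (negPf ad) (negPf cd).
  by case: (y a) (y b) (y c) (y d) => [] [] [] [].
by rewrite k1a k1d k2a k2d.
Qed.

(** Minimum and maximum are monotone: the minimum on [a] stays below that on [b], and the maximum on
    [c] below that on [d]. *)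
Lemma respects_sort_pairs a b c d y : uniq [:: a; b; c; d] ->
  (a, b) \in L1 -> (c, d) \in L1 -> respects L1 y ->
  respects L1 (sort_pair a c (sort_pair b d y)).
Proof.
rewrite /= !inE !negb_or -!andbA => /and5P[ab ac ad bc /and3P[bd cd _]].
move=> abL cdL hy k kL; have := hy k kL.
have := hy _ abL; have := hy _ cdL.
rewrite !ffunE /=.
rewrite (negPf ab) (negPf ad) (negPf cd) [c == b]eq_sym (negPf bc).
case: (layer_disjoint layerL1 abL kL) => [->|[k1a k1b k2a k2b]] /=.
  rewrite !eqxx [b == a]eq_sym (negPf ab) (negPf bc).
  by case: (y a) (y b) (y c) (y d) => [] [] [] [].
case: (layer_disjoint layerL1 cdL kL) => [->|[k1c k1d k2c k2d]] /=.
  rewrite !eqxx ![_ == a]eq_sym [d == c]eq_sym [d == b]eq_sym.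
  rewrite (negPf ac) (negPf ad) (negPf cd) (negPf bd).
  by case: (y a) (y b) (y c) (y d) => [] [] [] [].
by rewrite k1a k1b k1c k1d k2a k2b k2c k2d.
Qed.

Lemma sort_pair_commute a b c d y : uniq [:: a; b; c; d] ->
  sort_pair a c (sort_pair b d y) = sort_pair b d (sort_pair a c y).
Proof.
rewrite /= !inE !negb_or -!andbA => /and5P[ab ac ad bc /and3P[bd cd _]].
apply/ffunP => k; rewrite !ffunE.
rewrite [b == a]eq_sym [c == b]eq_sym [d == a]eq_sym [d == c]eq_sym.
rewrite (negPf ab) (negPf bc) (negPf ad) (negPf cd).
have [->|ka] := eqVneq k a; first by rewrite (negPf ab) (negPf ad).
have [->|//] := eqVneq k c.
by rewrite eq_sym (negPf bc) (negPf cd).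
Qed.

Lemma saturated_no_lower_join a b c d : uniq [:: a; b; c; d] ->
  (a, b) \in L1 -> (c, d) \in L1 -> (a, c) \in L2 ->
  ~~ used L2 b -> ~~ used L2 d -> False.
Proof.
move=> abcd abL cdL acL bL2 dL2.
have bd : b != d.
  by move: abcd; rewrite /= !inE !negb_or -!andbA => /and5P[_ _ _ _ /andP[]].
apply: (saturated_pair bd bL2 dL2) => y hy.
exists (sort_pair a c (sort_pair b d y)); first exact: respects_sort_pairs.
by rewrite (apply_layer_absorb _ layerL2 acL).
Qed.

Lemma saturated_no_upper_join a b c d : uniq [:: a; b; c; d] ->
  (a, b) \in L1 -> (c, d) \in L1 -> (b, d) \in L2 ->
  ~~ used L2 a -> ~~ used L2 c -> False.
Proof.
move=> abcd abL cdL bdL aL2 cL2.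
have ac : a != c.
  by move: abcd; rewrite /= !inE !negb_or -!andbA => /and3P[].
apply: (saturated_pair ac aL2 cL2) => y hy.
exists (sort_pair a c (sort_pair b d y)); first exact: respects_sort_pairs.
(* Here [L2] compares [b] and [d], so that sort must be outermost to be absorbed. *)
by rewrite sort_pair_commute // (apply_layer_absorb _ layerL2 bdL).
Qed.

End Boolean.

Theorem theorem4 (n : nat) (L1 L2 : layer n)
    (hC : is_network [:: L1; L2]) (hsat : saturated [:: L1; L2]) :
  (* 1a *)
  (~ exists a b c : 'I_n,
     uniq [:: a; b; c] /\ (a, b) \in L1 /\ ~~ used L1 c /\ ~~ used L2 c /\
     ~~ used L2 b /\ joined_ext L2 [:: a; b; c] a) /\
  (* 1b *)
  (~ exists a b c : 'I_n,
     uniq [:: a; b; c] /\ (a, b) \in L1 /\ ~~ used L1 c /\ ~~ used L2 c /\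
     ~~ used L2 a /\ joined_ext L2 [:: a; b; c] b) /\
  (* 1c *)
  (~ exists a b c : 'I_n,
     uniq [:: a; b; c] /\ (a, b) \in L1 /\ ~~ used L1 c /\ ~~ used L2 c /\
     ~~ used L2 a /\ ~~ used L2 b) /\
  (* 2 *)
  (~ exists a b c d : 'I_n,
     uniq [:: a; b; c; d] /\ (a, b) \in L1 /\ (c, d) \in L1 /\
     ~~ used L2 a /\ ~~ used L2 d /\
     joined_ext L2 [:: a; b; c; d] b /\ joined_ext L2 [:: a; b; c; d] c) /\
  (* 3a *)
  (~ exists a b c d : 'I_n,
     uniq [:: a; b; c; d] /\ (a, b) \in L1 /\ (c, d) \in L1 /\
     joined L2 a c /\ ~~ used L2 b /\ ~~ used L2 d) /\
  (* 3b *)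
  (~ exists a b c d : 'I_n,
     uniq [:: a; b; c; d] /\ (a, b) \in L1 /\ (c, d) \in L1 /\
     joined L2 b d /\ ~~ used L2 a /\ ~~ used L2 c).
Proof.
have layerL1 : is_layer L1 by apply: hC; rewrite mem_head.
have layerL2 : is_layer L2 by apply: hC; rewrite inE mem_head orbT.
(* In (3) the comparator of [L2] may point either way; exchanging the two comparators of [L1]
   reduces one direction to the other. *)
have swap (a b c d : 'I_n) : uniq [:: a; b; c; d] -> uniq [:: c; d; a; b].
  by rewrite (uniq_catC [:: a; b] [:: c; d]).
do !split.
- case=> a [b [c [abc [abL [cL1 [cL2 [bL2 _]]]]]]].
  apply: (saturated_no_upper layerL1 layerL2 hsat abL _ cL1 cL2 bL2).
  by rewrite eq_sym; move: abc; rewrite /= !inE negb_or -!andbA => /and4P[].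
- case=> a [b [c [abc [abL [cL1 [cL2 [aL2 _]]]]]]].
  apply: (saturated_no_lower layerL1 layerL2 hsat abL _ cL1 cL2 aL2).
  by move: abc; rewrite /= !inE negb_or -!andbA => /and4P[].
(* In (1c) [a] is free in [L2], so the argument for (1b) applies again. *)
- case=> a [b [c [abc [abL [cL1 [cL2 [aL2 _]]]]]]].
  apply: (saturated_no_lower layerL1 layerL2 hsat abL _ cL1 cL2 aL2).
  by move: abc; rewrite /= !inE negb_or -!andbA => /and4P[].
- case=> a [b [c [d [abcd [abL [cdL [aL2 [dL2 _]]]]]]]].
  exact: (saturated_no_lower_upper layerL1 layerL2 hsat abcd abL cdL).
- case=> a [b [c [d [abcd [abL [cdL [/orP[acL|caL] [bL2 dL2]]]]]]]].
    exact: (saturated_no_lower_join layerL1 layerL2 hsat abcd abL cdL).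
  exact: (saturated_no_lower_join layerL1 layerL2 hsat (swap _ _ _ _ abcd) cdL abL).
- case=> a [b [c [d [abcd [abL [cdL [/orP[bdL|dbL] [aL2 cL2]]]]]]]].
    exact: (saturated_no_upper_join layerL1 layerL2 hsat abcd abL cdL).
  exact: (saturated_no_upper_join layerL1 layerL2 hsat (swap _ _ _ _ abcd) cdL abL).
Qed.
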